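(* Let $\alpha\in\mathbb{C}$. The birational transformation $\varphi_0$ $$x=u,\qquad y=\frac{du}{dt}-\frac{3+\sqrt3}{2}u^2,\qquad z=\frac{d^2u}{dt^2}-(3+\sqrt3)u\frac{du}{dt}$$ takes the Chazy X.a equation $$\frac{d^3u}{dt^3}=6u^2\frac{du}{dt}+\frac{3}{11}(9+7\sqrt3)\left(\frac{du}{dt}+u^2\right)^2-\frac{1}{22}(4-3\sqrt3)\alpha\frac{du}{dt}+\frac{1}{44}(3-5\sqrt3)\alpha u^2-\frac{1}{352}(9+7\sqrt3)\alpha^2$$ to the system of first-order ordinary differential equations $$\begin{aligned} \frac{dx}{dt}&=\frac{3+\sqrt3}{2}x^2+y,\\ \frac{dy}{dt}&=z,\\ \frac{dz}{dt}&=\frac{2}{11}(-3+5\sqrt3)y^2-(3+\sqrt3)xz+\frac{1}{22}(-4+3\sqrt3)\alpha y-\frac{1}{352}(9+7\sqrt3)\alpha^2 . \end{aligned}$$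
   Context: $u$ is an unknown complex function of the complex variable $t$. A scalar third-order equation for $u$ is identified with a first-order system in $(u,u',u'')$. That a birational transformation ''takes'' the equation to the system means that it is a birational map from $(u,u',u'')$-space to $(x,y,z)$-space mapping solutions of the equation to solutions of the system, and conversely via the inverse map. *)

(* Defs.v *)
From mathcomp Require Import all_boot all_order all_algebra fraction.
From mathcomp Require Import complex.
(* The notations of mpoly clash with those of mathcomp-analysis. *)
From mathcomp Require Import -(notations) mpoly.
From mathcomp Require Import boolp classical_sets reals topology normedtype.
From mathcomp Require Import derive.

Set Implicit Arguments.
Unset Strict Implicit.
Unset Printing Implicit Defensive.

Import Order.TTheory GRing.Theory Num.Theory.
Import numFieldNormedType.Exports.

Local Open Scope ring_scope.

(* The complex numbers, seen as a numFieldType: this gives them their topology,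
   and derivatives of functions C -> C are then complex derivatives. *)
Definition Cplx (R : realType) : numFieldType := R[i].

Definition sqrt3 (R : realType) : Cplx R := real_complex R (Num.sqrt 3).

Section RationalMaps.
Variables (K : fieldType) (n : nat).

Definition mvar (i : 'I_n) : mpoly n K :=
  mpolyX K (mnm1 i).

Definition ratfun := {fraction (mpoly n K)}.

(* f is regular at v, with value w: some representation of f as p / q has
   q(v) <> 0; w does not depend on the representation. *)
Definition ratfun_value (f : ratfun) (v : 'I_n -> K) (w : K) : Prop :=
  exists p q : mpoly n K,
    [/\ f = tofrac p / tofrac q, meval v q != 0
      & w = meval v p / meval v q].

Definition ratmap := 'I_n -> ratfun.

Definition ratmap_value (phi : ratmap) (v w : 'I_n -> K) : Prop :=
  forall i, ratfun_value (phi i) v (w i).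

(* psi \o phi is defined and equal to the identity as a rational map. It is
   defined as soon as phi is regular at one v with psi regular at phi(v); the
   set of such v is then Zariski dense, if K is infinite. *)
Definition ratmap_cancel (phi psi : ratmap) : Prop :=
  (exists v w v', ratmap_value phi v w /\ ratmap_value psi w v') /\
  (forall v w v', ratmap_value phi v w -> ratmap_value psi w v' -> v' =1 v).

Definition birational_inverse (phi psi : ratmap) : Prop :=
  ratmap_cancel phi psi /\ ratmap_cancel psi phi.

End RationalMaps.

Section DifferentialEquations.
Variable R : realType.
Local Notation C := (Cplx R).

Definition pt3 (x y z : C) : 'I_3 -> C := tnth [tuple x; y; z].

(* Solutions on D of  u''' = F (u, u', u''). *)
Definition solves_third_order (F : C -> C -> C -> C) (D : set C) (u : C -> C) :=
  forall t, D t ->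
    [/\ derivable u t 1, derivable (derive1n 1 u) t 1,
        derivable (derive1n 2 u) t 1
      & derive1n 3 u t = F (u t) (derive1n 1 u t) (derive1n 2 u t)].

(* Solutions on D of  x' = f (x, y, z), y' = g (x, y, z), z' = h (x, y, z). *)
Definition solves_system (f g h : C -> C -> C -> C) (D : set C)
    (x y z : C -> C) :=
  forall t, D t ->
    [/\ is_derive t 1 x (f (x t) (y t) (z t)),
        is_derive t 1 y (g (x t) (y t) (z t))
      & is_derive t 1 z (h (x t) (y t) (z t))].

(* phi is a birational map from (u, u', u'')-space to (x, y, z)-space which
   maps solutions of the equation to solutions of the system, and whose inverse
   psi maps solutions of the system to solutions of the equation. Solutions are
   holomorphic functions on a domain D of the complex plane. *)
Definition takes_equation_to_system (phi : ratmap C 3)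
    (F f g h : C -> C -> C -> C) : Prop :=
  exists psi : ratmap C 3,
    [/\ birational_inverse phi psi,
        (forall (D : set C) (u : C -> C),
           open D -> connected D -> solves_third_order F D u ->
           exists x y z : C -> C,
             solves_system f g h D x y z /\
             forall t, D t ->
               ratmap_value phi
                 (pt3 (u t) (derive1n 1 u t) (derive1n 2 u t))
                 (pt3 (x t) (y t) (z t)))
      & (forall (D : set C) (x y z : C -> C),
           open D -> connected D -> solves_system f g h D x y z ->
           exists u : C -> C,
             solves_third_order F D u /\
             forall t, D t ->
               ratmap_value psi
                 (pt3 (x t) (y t) (z t))
                 (pt3 (u t) (derive1n 1 u t) (derive1n 2 u t)))].

Definition phi0 : ratmap C 3 :=
  let cst (c : C) : mpoly 3 C := mpolyC 3 c in
  let U := mvar C (inord 0 : 'I_3) in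
  let V := mvar C (inord 1 : 'I_3) in
  let W := mvar C (inord 2 : 'I_3) in
  fun i => tofrac (tnth [tuple U;
                               V - cst ((3 + sqrt3 R) / 2) * U ^+ 2;
                               W - cst (3 + sqrt3 R) * U * V] i).

Definition chazyXa (alpha u u' u'' : C) : C :=
  6 * u ^+ 2 * u'
  + 3 / 11 * (9 + 7 * sqrt3 R) * (u' + u ^+ 2) ^+ 2
  - 1 / 22 * (4 - 3 * sqrt3 R) * alpha * u'
  + 1 / 44 * (3 - 5 * sqrt3 R) * alpha * u ^+ 2
  - 1 / 352 * (9 + 7 * sqrt3 R) * alpha ^+ 2.

End DifferentialEquations.

(* Main.v *)
Require Import Defs.
From mathcomp Require Import all_boot all_order all_algebra.
From mathcomp Require Import reals.
From mathcomp Require Import fraction complex ring.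
From mathcomp Require Import -(notations) mpoly.
From mathcomp Require Import boolp classical_sets functions topology normedtype.
From mathcomp Require Import derive.
Import Order.TTheory GRing.Theory Num.Theory.
Import numFieldNormedType.Exports.
Local Open Scope ring_scope.

(** The map phi0 is triangular: x is u itself, y is v = u' shifted by a
    polynomial in u, and z is w = u'' shifted by a polynomial in (u, v). Hence
    it is a bijection of the affine space whose inverse [psi0] is again
    polynomial. A rational map with polynomial components is defined everywhere
    and its values are those of the polynomials ([ratmap_value_tofrac]), so the
    two are inverse to each other as rational maps ([phi0_birational]).

    For the differential part, put a = (3 + sqrt 3) / 2. On an open set a
    solution of u''' = F (u, u', u'') is the same as a triple (u, v, w) with
    u' = v, v' = w, w' = F (u, v, w). In these coordinates x' = a x^2 + y and
    y' = z merely restate the definitions of y = v - a u^2 and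
    z = w - 2 a u v, while z' = w' - 2 a (v^2 + u w). So the only content
    specific to the Chazy equation is the polynomial identity
      h (x, y, z) = F (u, v, w) - 2 a (v^2 + u w)
    for the right-hand side h of the third equation of the system
    ([chazyXa_phi0]); it holds modulo (sqrt 3)^2 = 3. The same identity, read
    at x, y + a x^2 and z + 2 a x v, gives the converse direction. *)

Section PolynomialMaps.
Context {K : fieldType} {n : nat}.
Implicit Types (v w : 'I_n -> K) (p q : 'I_n -> mpoly n K).

(** A polynomial p may also be written as a fraction a / b with b not
    constant; clearing the denominator gives a = p b, so that the value
    a(v) / b(v) is still p(v). *)
Lemma ratfun_value_tofrac (p : mpoly n K) v (c : K) :
  ratfun_value (tofrac p) v c <-> c = meval v p.
Proof.
split=> [[a [b [pab bv0 ->]]] | ->]; last first.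
  exists p, 1; split; first by rewrite tofrac1 divr1.
  - by rewrite meval1 oner_neq0.
  - by rewrite meval1 divr1.
have b0 : tofrac b != 0.
  by rewrite tofrac_eq0; apply: contraNneq bv0 => ->; rewrite meval0.
have -> : a = p * b.
  by apply/eqP; rewrite -tofrac_eq tofracM pab divfK.
by rewrite mevalM mulfK.
Qed.

Lemma ratmap_value_tofrac p v w :
  ratmap_value (fun i => tofrac (p i)) v w <-> w = fun i => meval v (p i).
Proof.
split=> [h | -> i]; last exact/ratfun_value_tofrac.
by apply/funext => i; apply/ratfun_value_tofrac/h.
Qed.

Lemma ratmap_cancel_tofrac p q :
    (forall v, (fun i => meval (fun j => meval v (p j)) (q i)) =1 v) ->
  ratmap_cancel (fun i => tofrac (p i)) (fun i => tofrac (q i)).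
Proof.
move=> pqK; split=> [|v w v' /ratmap_value_tofrac -> /ratmap_value_tofrac -> //].
exists (fun=> 0); do 2 eexists.
by split; apply/ratmap_value_tofrac.
Qed.

End PolynomialMaps.

Section Derivatives.
Context {K : numFieldType} {W : normedModType K}.
Implicit Types (f g : K -> W) (t : K).

Lemma derivable_is_derive1 f t :
  derivable f t 1 -> is_derive t 1 f (derive1 f t).
Proof. by move=> df; rewrite derive1E; apply/derivableP. Qed.

Lemma is_derive_derive1 f t df : is_derive t 1 f df -> derive1 f t = df.
Proof. by move=> fdf; rewrite derive1E derive_val. Qed.

Lemma is_derive_eq_on (D : set K) f g t df :
  open D -> D t -> (forall r, D r -> f r = g r) ->
  is_derive t 1 f df -> is_derive t 1 g df.
Proof.
move=> oD Dt fg; apply: near_eq_is_derive; near=> r; apply: fg.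
by near: r; apply: open_nbhs_nbhs.
Unshelve. all: by end_near.
Qed.

End Derivatives.

Section ThirdOrder.
Context {R : realType}.
Local Notation C := (Cplx R).

Lemma solves_third_order_is_derive F (D : set C) (u : C -> C) :
  solves_third_order F D u -> forall t, D t ->
    [/\ is_derive t 1 u (derive1n 1 u t),
        is_derive t 1 (derive1n 1 u) (derive1n 2 u t)
      & is_derive t 1 (derive1n 2 u)
          (F (u t) (derive1n 1 u t) (derive1n 2 u t))].
Proof.
move=> uF t /uF[d0 d1 d2 d3].
by split; [| |rewrite -d3]; apply: derivable_is_derive1.
Qed.

(** The functions v and w agree with the iterated derivatives of u on D only,
    whereas differentiating u' and u'' at a point of D involves a
    neighbourhood of that point: this is where openness of D enters. *)
Lemma is_derive_solves_third_order F (D : set C) (u v w : C -> C) :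
    open D ->
    (forall t, D t ->
      [/\ is_derive t 1 u (v t), is_derive t 1 v (w t)
        & is_derive t 1 w (F (u t) (v t) (w t))]) ->
  solves_third_order F D u /\
  (forall t, D t -> derive1n 1 u t = v t /\ derive1n 2 u t = w t).
Proof.
move=> oD uvw.
have u1 t : D t -> derive1n 1 u t = v t.
  by case/uvw=> /is_derive_derive1.
have du1 t : D t -> is_derive t 1 (derive1n 1 u) (w t).
  move=> Dt; have [_ dv _] := uvw t Dt.
  by apply: is_derive_eq_on oD Dt _ dv => r /u1.
have u2 t : D t -> derive1n 2 u t = w t.
  by move=> /du1/is_derive_derive1.
have du2 t : D t -> is_derive t 1 (derive1n 2 u) (F (u t) (v t) (w t)).
  move=> Dt; have [_ _ dw] := uvw t Dt.
  by apply: is_derive_eq_on oD Dt _ dw => r /u2.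
split=> t Dt; last by rewrite u1 ?u2.
have [du _ _] := uvw t Dt.
split.
- exact: ex_derive.
- exact: (@ex_derive _ _ _ _ _ _ _ (du1 t Dt)).
- exact: (@ex_derive _ _ _ _ _ _ _ (du2 t Dt)).
- by rewrite u1 ?u2 //; apply: is_derive_derive1; apply: du2.
Qed.

End ThirdOrder.

Section Chazy.
Context {R : realType}.
Local Notation C := (Cplx R).
Local Notation s := (sqrt3 R).
Local Notation a := ((3 + s) / 2).
Implicit Types (alpha u v w x y z t : C).

Lemma pt3_inord x y z :
  (pt3 x y z (inord 0) = x) * (pt3 x y z (inord 1) = y) *
  (pt3 x y z (inord 2) = z).
Proof. by rewrite /pt3 !(tnth_nth 0) !inordK. Qed.

Lemma pt3_eta (p : 'I_3 -> C) :
  pt3 (p (inord 0)) (p (inord 1)) (p (inord 2)) = p.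
Proof.
apply/funext => i; rewrite /pt3 (tnth_nth 0).
by case: i => [[|[|[|//]]] ilt] /=; congr p; apply/val_inj; rewrite /= inordK.
Qed.

Let cst (c : C) : mpoly 3 C := mpolyC 3 c.
Let X i : mpoly 3 C := mvar C (inord i : 'I_3).

(** The polynomials whose fractions are the components of phi0, so that
    [phi0 R] is convertible to [fun i => tofrac (phi0_poly i)]. *)
Definition phi0_poly : 'I_3 -> mpoly 3 C :=
  tnth [tuple X 0; X 1 - cst a * X 0 ^+ 2; X 2 - cst (3 + s) * X 0 * X 1].

Definition psi0_poly : 'I_3 -> mpoly 3 C :=
  tnth [tuple X 0; X 1 + cst a * X 0 ^+ 2;
              X 2 + cst (3 + s) * X 0 * (X 1 + cst a * X 0 ^+ 2)].

(** The inverse of phi0, found by solving its triangular equations for u,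
    then v, then w. *)
Definition psi0 : ratmap C 3 := fun i => tofrac (psi0_poly i).

Lemma meval_phi0 u v w :
  (fun i => meval (pt3 u v w) (phi0_poly i)) =
  pt3 u (v - a * u ^+ 2) (w - (3 + s) * u * v).
Proof.
rewrite -[LHS]pt3_eta /phi0_poly !(tnth_nth 0) !inordK //=.
by rewrite !(mevalB, mevalM, rmorphXn, mevalC, mevalXU) !pt3_inord.
Qed.

Lemma meval_psi0 x y z :
  (fun i => meval (pt3 x y z) (psi0_poly i)) =
  pt3 x (y + a * x ^+ 2) (z + (3 + s) * x * (y + a * x ^+ 2)).
Proof.
rewrite -[LHS]pt3_eta /psi0_poly !(tnth_nth 0) !inordK //=.
by rewrite !(mevalD, mevalM, rmorphXn, mevalC, mevalXU) !pt3_inord.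
Qed.

Lemma phi0_birational : birational_inverse (phi0 R) psi0.
Proof.
split; apply: ratmap_cancel_tofrac => p i; rewrite -[p]pt3_eta.
- by rewrite meval_phi0 (congr1 (@^~ i) (meval_psi0 _ _ _)) !subrK.
- by rewrite meval_psi0 (congr1 (@^~ i) (meval_phi0 _ _ _)) !addrK.
Qed.

Lemma sqrt3_sqr : s ^+ 2 = 3.
Proof.
rewrite /sqrt3 -[LHS](rmorphXn (real_complex R)) sqr_sqrtr ?ler0n //.
exact: (rmorph_nat (real_complex R)).
Qed.

(** As (w - (3 + s) u v)' = w' - (3 + s) (v^2 + u w) when u' = v and v' = w,
    this equates the third equation of the system with the Chazy equation for
    w'. Both sides are polynomials in u, v, w, alpha whose coefficients agree
    once s^2 is reduced to 3: for instance 2 / 11 (-3 + 5 s) a^2, the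
    coefficient of u^4, becomes 3 / 11 (9 + 7 s). *)
Lemma chazyXa_phi0 alpha u v w :
  2 / 11 * (- 3 + 5 * s) * (v - a * u ^+ 2) ^+ 2
    - (3 + s) * u * (w - (3 + s) * u * v)
    + 1 / 22 * (- 4 + 3 * s) * alpha * (v - a * u ^+ 2)
    - 1 / 352 * (9 + 7 * s) * alpha ^+ 2
  = chazyXa alpha u v w - (3 + s) * (v ^+ 2 + u * w).
Proof.
have s2 := sqrt3_sqr; rewrite /chazyXa.
by field : s2.
Qed.

Lemma is_derive_phi0 alpha (u v w : C -> C) t :
    is_derive t 1 u (v t) -> is_derive t 1 v (w t) ->
    is_derive t 1 w (chazyXa alpha (u t) (v t) (w t)) ->
  let y r := v r - a * u r ^+ 2 in
  let z r := w r - (3 + s) * u r * v r in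
  [/\ is_derive t 1 u (a * u t ^+ 2 + y t), is_derive t 1 y (z t)
    & is_derive t 1 z (2 / 11 * (- 3 + 5 * s) * y t ^+ 2
        - (3 + s) * u t * z t
        + 1 / 22 * (- 4 + 3 * s) * alpha * y t
        - 1 / 352 * (9 + 7 * s) * alpha ^+ 2)].
Proof.
move=> du dv dw y z; split.
- by rewrite addrC subrK.
- have -> : y = v - a *: u ^+ 2 by [].
  apply: (is_derive_eq (is_deriveB dv (is_deriveZ a (is_deriveX 2 du)))).
  by rewrite /z /GRing.scale/=; field.
- rewrite /y /z chazyXa_phi0.
  have -> : (fun r => w r - (3 + s) * u r * v r) = w - (3 + s) *: (u * v).
    by apply/funext => r; rewrite -mulrA.
  apply: (is_derive_eq (is_deriveB dw (is_deriveZ (3 + s) (is_deriveM du dv)))).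
  by rewrite /GRing.scale/=; ring.
Qed.

Lemma is_derive_psi0 alpha (x y z : C -> C) t :
    is_derive t 1 x (a * x t ^+ 2 + y t) -> is_derive t 1 y (z t) ->
    is_derive t 1 z (2 / 11 * (- 3 + 5 * s) * y t ^+ 2
      - (3 + s) * x t * z t
      + 1 / 22 * (- 4 + 3 * s) * alpha * y t
      - 1 / 352 * (9 + 7 * s) * alpha ^+ 2) ->
  let v r := y r + a * x r ^+ 2 in
  let w r := z r + (3 + s) * x r * v r in
  [/\ is_derive t 1 x (v t), is_derive t 1 v (w t)
    & is_derive t 1 w (chazyXa alpha (x t) (v t) (w t))].
Proof.
move=> dx dy dz v w.
have dv : is_derive t 1 v (w t).
  have -> : v = y + a *: x ^+ 2 by [].
  apply: (is_derive_eq (is_deriveD dy (is_deriveZ a (is_deriveX 2 dx)))).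
  by rewrite /w /v /GRing.scale/=; field.
split; [by rewrite /v addrC | exact: dv | ].
have -> : w = z + (3 + s) *: (x * v).
  by apply/funext => r; rewrite /w -mulrA.
apply: (is_derive_eq (is_deriveD dz (is_deriveZ (3 + s) (is_deriveM dx dv)))).
rewrite /GRing.scale/=.
(* Unfolding v and w in the right places makes y and z reappear on the left of
   the identity, where they are v - a x^2 and w - (3 + s) x v. *)
have := chazyXa_phi0 alpha (x t) (v t) (w t).
rewrite {1 3}/v addrK {1}/w addrK => ->.
by rewrite /v; ring.
Qed.

End Chazy.

Theorem theorem12p1 (R : realType) (alpha : Cplx R) :
  takes_equation_to_system (phi0 R)
    (chazyXa alpha)
    (fun x y z => (3 + sqrt3 R) / 2 * x ^+ 2 + y)
    (fun x y z => z)
    (fun x y z =>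
       2 / 11 * (- 3 + 5 * sqrt3 R) * y ^+ 2
       - (3 + sqrt3 R) * x * z
       + 1 / 22 * (- 4 + 3 * sqrt3 R) * alpha * y
       - 1 / 352 * (9 + 7 * sqrt3 R) * alpha ^+ 2).
Proof.
exists psi0; split; first exact: phi0_birational.
- move=> D u oD _ /solves_third_order_is_derive uD.
  (* The witnesses for x, y, z are dictated by is_derive_phi0. *)
  do 3 eexists; split=> t Dt; first by have [] := uD t Dt; exact: is_derive_phi0.
  by apply/ratmap_value_tofrac; rewrite meval_phi0.
- move=> D x y z oD _ xyzD.
  exists x.
  pose v t := y t + (3 + sqrt3 R) / 2 * x t ^+ 2.
  pose w t := z t + (3 + sqrt3 R) * x t * v t.
  have [t Dt|xF x12] :=
    is_derive_solves_third_order (chazyXa alpha) D x v w oD.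
    by have [dx dy dz] := xyzD t Dt; exact: is_derive_psi0 dx dy dz.
  split=> // t Dt; have [-> ->] := x12 t Dt.
  by apply/ratmap_value_tofrac; rewrite meval_psi0.
Qed.
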